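(* Let $A=(a_{ij})\in M_n(\mathbb{H})$ with $a_{ii}\in\mathbb{R}$ for all $1\le i\le n$, and let $\gamma\in[0,1]$. Then all the right eigenvalues of $A$ are located in the union of the $n$ balls $G_i(A):=\{z\in\mathbb{H}: |z-a_{ii}|\le r_i(A)^{\gamma}\,c_i(A)^{1-\gamma}\}$, $1\le i\le n$; that is, $$\Lambda_r(A)\subseteq G(A):=\bigcup_{i=1}^n G_i(A).$$
   Context: $\mathbb{H}$ is the skew field of real quaternions with its usual modulus $|\cdot|$, and $M_n(\mathbb{H})$ is the set of $n\times n$ quaternionic matrices. A quaternion $\lambda$ is a right eigenvalue of $A$ if $Ax=x\lambda$ for some nonzero column vector $x\in\mathbb{H}^n$; $\Lambda_r(A)$ is the set of right eigenvalues. $r_i(A):=\sum_{j\ne i}|a_{ij}|$ and $c_i(A):=\sum_{j\neq i}|a_{ji}|$. Convention: $0^0=1$. *)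

(* Defs.v *)
From HB Require Import structures.
From mathcomp Require Import all_boot all_order all_algebra.
From mathcomp Require Import ring lra.
From mathcomp Require Import all_classical all_reals all_analysis.
Set Implicit Arguments.
Unset Strict Implicit.
Unset Printing Implicit Defensive.
Import Order.TTheory GRing.Theory Num.Theory.
Local Open Scope ring_scope.
Local Open Scope classical_set_scope.

(* [Quat a b c d] stands for a + b i + c j + d k. *)
Record quaternion (R : Type) : Type :=
  Quat { qre : R; qimi : R; qimj : R; qimk : R }.

Section QuaternionRing.
Variable R : realType.
Local Notation H := (quaternion R).
Implicit Types p q r : H.

Definition quat_tuple q := (qre q, qimi q, qimj q, qimk q).
Definition tuple_quat (t : R * R * R * R) : H :=
  let: (a, b, c, d) := t in Quat a b c d.
Lemma quat_tupleK : cancel quat_tuple tuple_quat. Proof. by case. Qed.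

HB.instance Definition _ := Choice.copy H (can_type quat_tupleK).

Definition quat_real (a : R) : H := Quat a 0 0 0.
Definition addq p q : H :=
  Quat (qre p + qre q) (qimi p + qimi q) (qimj p + qimj q) (qimk p + qimk q).
Definition oppq q : H := Quat (- qre q) (- qimi q) (- qimj q) (- qimk q).

(* Hamilton product: i^2 = j^2 = k^2 = -1, ij = k, jk = i, ki = j. *)
Definition mulq p q : H :=
  let: Quat a b c d := p in
  let: Quat a' b' c' d' := q in
  Quat (a * a' - b * b' - c * c' - d * d')
       (a * b' + b * a' + c * d' - d * c')
       (a * c' - b * d' + c * a' + d * b')
       (a * d' + b * c' - c * b' + d * a').

Fact addqA : associative addq.
Proof. by case=> ? ? ? ? [? ? ? ?] [? ? ? ?]; congr Quat; rewrite /= addrA. Qed.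
Fact addqC : commutative addq.
Proof. by case=> ? ? ? ? [? ? ? ?]; congr Quat; rewrite /= addrC. Qed.
Fact add0q : left_id (quat_real 0) addq.
Proof. by case=> ? ? ? ?; congr Quat; rewrite /= add0r. Qed.
Fact addNq : left_inverse (quat_real 0) oppq addq.
Proof. by case=> ? ? ? ?; congr Quat; rewrite /= addNr. Qed.

HB.instance Definition _ := GRing.isZmodule.Build H addqA addqC add0q addNq.

Fact mulqA : associative mulq.
Proof. by case=> ? ? ? ? [? ? ? ?] [? ? ? ?]; congr Quat; ring. Qed.
Fact mul1q : left_id (quat_real 1) mulq.
Proof. by case=> ? ? ? ?; congr Quat; ring. Qed.
Fact mulq1 : right_id (quat_real 1) mulq.
Proof. by case=> ? ? ? ?; congr Quat; ring. Qed.
Fact mulqDl : left_distributive mulq +%R.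
Proof. by case=> ? ? ? ? [? ? ? ?] [? ? ? ?]; congr Quat; rewrite /=; ring. Qed.
Fact mulqDr : right_distributive mulq +%R.
Proof. by case=> ? ? ? ? [? ? ? ?] [? ? ? ?]; congr Quat; rewrite /=; ring. Qed.
Fact oneq_neq0 : quat_real 1 != 0.
Proof. by apply/eqP => -[] /eqP; rewrite oner_eq0. Qed.

HB.instance Definition _ :=
  GRing.Zmodule_isNzRing.Build H mulqA mul1q mulq1 mulqDl mulqDr oneq_neq0.

Definition sqnormq q : R :=
  qre q ^+ 2 + qimi q ^+ 2 + qimj q ^+ 2 + qimk q ^+ 2.
Definition normq q : R := Num.sqrt (sqnormq q).
Definition conjq q : H := Quat (qre q) (- qimi q) (- qimj q) (- qimk q).
Definition invq q : H := quat_real (sqnormq q)^-1 * conjq q.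

Lemma sqnormq_ge0 q : 0 <= sqnormq q.
Proof. by rewrite !addr_ge0// sqr_ge0. Qed.

Lemma sqnormq_eq0 q : sqnormq q = 0 -> q = 0.
Proof.
case: q => a b c d; rewrite /sqnormq /= => /eqP.
rewrite !paddr_eq0 ?addr_ge0 ?sqr_ge0// !sqrf_eq0.
by move=> /andP[/andP[/andP[/eqP-> /eqP->] /eqP->] /eqP->].
Qed.

Lemma sqnormqM p q : sqnormq (p * q) = sqnormq p * sqnormq q.
Proof.
rewrite -[p * q]/(mulq p q).
by case: p q => ? ? ? ? [? ? ? ?]; rewrite /sqnormq /=; ring.
Qed.

Fact mulVq : {in [pred q : H | q != 0], left_inverse 1 invq *%R}.
Proof.
move=> q; rewrite inE => q0; have s0 : sqnormq q != 0.
  by apply: contra q0 => /eqP/sqnormq_eq0 ->.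
rewrite -[LHS]/(mulq (mulq (quat_real (sqnormq q)^-1) (conjq q)) q) -[RHS]/(quat_real 1).
case: q s0 {q0} => a b c d; rewrite /sqnormq /= => s0.
by congr Quat; field.
Qed.
Fact mulqV : {in [pred q : H | q != 0], right_inverse 1 invq *%R}.
Proof.
move=> q; rewrite inE => q0; have s0 : sqnormq q != 0.
  by apply: contra q0 => /eqP/sqnormq_eq0 ->.
rewrite -[LHS]/(mulq q (mulq (quat_real (sqnormq q)^-1) (conjq q))) -[RHS]/(quat_real 1).
case: q s0 {q0} => a b c d; rewrite /sqnormq /= => s0.
by congr Quat; field.
Qed.
Fact unitqP p q : q * p = 1 /\ p * q = 1 -> [pred q : H | q != 0] p.
Proof.
by case=> + _; apply: contra_eqN => /eqP->; rewrite mulr0 eq_sym oner_eq0.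
Qed.
Fact invq_out : {in [predC [pred q : H | q != 0]], invq =1 id}.
Proof. by move=> q; rewrite !inE negbK => /eqP->; congr Quat; rewrite /=; ring. Qed.

HB.instance Definition _ :=
  GRing.NzRing_hasMulInverse.Build H mulVq mulqV unitqP invq_out.

Fact ler_normqD p q : normq (p + q) <= normq p + normq q.
Proof.
rewrite -ler_sqr ?nnegrE ?addr_ge0 ?sqrtr_ge0// sqrrD !sqr_sqrtr ?sqnormq_ge0//.
set s := normq p * normq q.
suff dot : qre p * qre q + qimi p * qimi q + qimj p * qimj q + qimk p * qimk q
           <= s.
  by move: dot; rewrite /sqnormq /=; nra.
apply: le_trans (ler_norm _) _.
rewrite -ler_sqr ?nnegrE ?mulr_ge0 ?sqrtr_ge0// real_normK ?num_real//.
rewrite exprMn !sqr_sqrtr ?sqnormq_ge0// /sqnormq.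
case: p q {s} => a b c d [a' b' c' d'] /=; rewrite -subr_ge0.
rewrite (_ : _ - _ = (a * b' - b * a') ^+ 2 + (a * c' - c * a') ^+ 2
  + (a * d' - d * a') ^+ 2 + (b * c' - c * b') ^+ 2 + (b * d' - d * b') ^+ 2
  + (c * d' - d * c') ^+ 2); last by ring.
by rewrite !addr_ge0// sqr_ge0.
Qed.
Fact normq_eq0 q : normq q = 0 -> q = 0.
Proof.
move=> /eqP; rewrite sqrtr_eq0 => h; apply: sqnormq_eq0.
by apply/eqP; rewrite eq_le h sqnormq_ge0.
Qed.
Fact normqMn q n : normq (q *+ n) = normq q *+ n.
Proof.
have qMn : q *+ n = quat_real n%:R * q.
  rewrite -[LHS]mulr_natl; congr (_ * _).
  by elim: n => // n IHn; rewrite -natr1 IHn; congr Quat; rewrite /= ?addr0 ?natr1.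
rewrite /normq qMn sqnormqM sqrtrM ?sqnormq_ge0//.
by rewrite /sqnormq /= expr0n /= !addr0 sqrtr_sqr ger0_norm// mulr_natl.
Qed.
Fact normqN q : normq (- q) = normq q.
Proof. by rewrite /normq /sqnormq /= !sqrrN. Qed.

HB.instance Definition _ :=
  Num.Zmodule_isNormed.Build R H ler_normqD normq_eq0 normqMn normqN.

Lemma quat_normE q :
  `|q| = Num.sqrt (qre q ^+ 2 + qimi q ^+ 2 + qimj q ^+ 2 + qimk q ^+ 2).
Proof. by []. Qed.

Lemma quat_normM p q : `|p * q| = `|p| * `|q|.
Proof. by rewrite /Num.norm /= /normq sqnormqM sqrtrM ?sqnormq_ge0. Qed.

End QuaternionRing.

Section RightEigenvalues.
Variables (R : realType) (n : nat).
Implicit Types A : 'M[quaternion R]_n.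

Definition right_eigenvalue A (lambda : quaternion R) : Prop :=
  exists2 x : 'cV[quaternion R]_n,
    x != 0 & A *m x = map_mx (fun q => q * lambda) x.

Definition right_spectrum A : set (quaternion R) :=
  [set lambda | right_eigenvalue A lambda].

Definition row_radius A (i : 'I_n) : R := \sum_(j < n | j != i) `|A i j|.
Definition col_radius A (i : 'I_n) : R := \sum_(j < n | j != i) `|A j i|.

(* [powR] satisfies 0 `^ 0 = 1 and 0 `^ x = 0 for x != 0. *)
Definition ostrowski_ball (gamma : R) A (i : 'I_n) : set (quaternion R) :=
  [set z | `|z - A i i| <=
           row_radius A i `^ gamma * col_radius A i `^ (1 - gamma)].

End RightEigenvalues.

(* Main.v *)
Require Import Defs.
From mathcomp Require Import all_boot all_order all_algebra.
From mathcomp Require Import all_classical all_reals all_analysis.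
Import Order.TTheory GRing.Theory Num.Theory.
Local Open Scope ring_scope.
Local Open Scope classical_set_scope.

(** Let [A x = x lambda] with [x != 0]. A real diagonal entry commutes with
    every quaternion, so the [i]-th coordinate of this equation reads
    [x_i (lambda - a_ii) = \sum_(j != i) a_ij x_j]. The modulus is
    multiplicative, so noncommutativity disappears on taking moduli: the
    nonnegative numbers [u_i = |x_i|], [d_i = |lambda - a_ii|] and
    [w_ij = |a_ij|] satisfy [u_i d_i <= \sum_(j != i) w_ij u_j], and some index
    [i] has to be found with [d_i <= r_i^gamma c_i^(1 - gamma)], where [r] and
    [c] are the off-diagonal row and column sums of [w]
    (lemma [exists_le_row_col_sums]).

    For [gamma = 1] an index maximizing [u] works, which is Gershgorin's
    argument. For [gamma < 1] put [y_i = u_i^(1 / (1 - gamma))] and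
    [S_i = \sum_(j != i) w_ij y_j]. Hoelder's inequality gives
    [u_i d_i <= r_i^gamma S_i^(1 - gamma)]. Exchanging the order of summation,
    [\sum_i S_i = \sum_i c_i y_i], hence [S_i <= c_i y_i] for some [i] with
    [y_i > 0]. At this index [u_i d_i <= r_i^gamma c_i^(1 - gamma) u_i], and
    [u_i > 0] cancels. *)

(** Young's inequality for the conjugate exponents [1 / g] and [1 / (1 - g)],
    applied to [a^g] and [b^(1 - g)]. *)
Lemma powR_weighted_AGM (R : realType) (g a b : R) : 0 <= g <= 1 ->
  0 <= a -> 0 <= b -> a `^ g * b `^ (1 - g) <= g * a + (1 - g) * b.
Proof.
move=> /andP[g0 g1] a0 b0.
have [->|gn0] := eqVneq g 0.
  by rewrite powRr0 subr0 powRr1// mul0r add0r !mul1r.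
have [->|gn1] := eqVneq g 1.
  by rewrite subrr powRr0 powRr1// mul0r addr0 mul1r mulr1.
have gp : 0 < g by rewrite lt_neqAle eq_sym gn0.
have hp : 0 < 1 - g by rewrite subr_gt0 lt_neqAle gn1.
have gVp : 0 < g^-1 by rewrite invr_gt0.
have hVp : 0 < (1 - g)^-1 by rewrite invr_gt0.
have pq1 : g^-1^-1 + (1 - g)^-1^-1 = 1 by rewrite !invrK addrC subrK.
have := conjugate_powR (powR_ge0 a g) (powR_ge0 b (1 - g)) gVp hVp pq1.
rewrite -!powRrM !mulfV ?gt_eqF// !powRr1// !invrK.
by rewrite (mulrC a) (mulrC b).
Qed.

(** Hoelder's inequality with weights [w] and exponents [1 / g] and
    [1 / (1 - g)], in the form of Jensen's inequality for the concave function
    [t |-> t^(1 - g)]. Each term is bounded by [powR_weighted_AGM] applied to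
    the weighted mean [m] of [y] and to [y i]. *)
Lemma holder_weighted_sum (R : realType) (I : finType) (P : pred I)
    (w y : I -> R) (g : R) : 0 <= g < 1 ->
  (forall i, 0 <= w i) -> (forall i, 0 <= y i) ->
  \sum_(i | P i) w i * y i `^ (1 - g) <=
  (\sum_(i | P i) w i) `^ g * (\sum_(i | P i) w i * y i) `^ (1 - g).
Proof.
move=> /andP[g0 g1] w0 y0.
have wy0 i : 0 <= w i * y i by rewrite mulr_ge0.
set W := \sum_(i | P i) w i; set S := \sum_(i | P i) w i * y i.
have W0 : 0 <= W by exact: sumr_ge0.
have S0 : 0 <= S by exact: sumr_ge0.
have h0 : 1 - g != 0 by rewrite subr_eq0 eq_sym lt_eqF.
have [WE|Wn0] := eqVneq W 0.
  have wE := psumr_eq0P (fun i _ => w0 i) WE.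
  rewrite big1 ?mulr_ge0 ?powR_ge0// => i Pi.
  by rewrite wE// mul0r.
have [SE|Sn0] := eqVneq S 0.
  have wyE := psumr_eq0P (fun i _ => wy0 i) SE.
  rewrite big1 ?mulr_ge0 ?powR_ge0// => i Pi.
  by have /eqP := wyE i Pi; rewrite mulf_eq0 => /orP[] /eqP->;
    rewrite ?mul0r// powR0// mulr0.
have Wp : 0 < W by rewrite lt_neqAle eq_sym Wn0.
have Sp : 0 < S by rewrite lt_neqAle eq_sym Sn0.
pose m := S / W.
have mp : 0 < m by rewrite divr_gt0.
have SE : S = W * m by rewrite mulrC divfK.
have powRsplit t : 0 < t -> t `^ g * t `^ (1 - g) = t.
  move=> t0; rewrite -powRD; last by rewrite (gt_eqF t0) implybT.
  by rewrite addrC subrK powRr1// ltW.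
rewrite -(ler_pM2l (powR_gt0 g mp)).
have -> : m `^ g * (W `^ g * S `^ (1 - g)) = S.
  by rewrite mulrA -powRM ?(ltW mp)// (mulrC m) -SE powRsplit.
have -> : S = \sum_(i | P i) w i * (g * m + (1 - g) * y i).
  under eq_bigr do rewrite mulrDr (mulrC _ (g * m)) (mulrCA _ (1 - g)).
  rewrite big_split/= -mulr_sumr -mulr_sumr -/W -/S.
  by rewrite -mulrA (mulrC m) -SE -mulrDl addrC subrK mul1r.
rewrite mulr_sumr; apply: ler_sum => i _.
rewrite mulrCA ler_wpM2l//.
by apply: powR_weighted_AGM => //; [rewrite g0 ltW | exact: ltW].
Qed.

(** A real, entrywise nonnegative form of Ostrowski's theorem: [u] plays the
    moduli of the coordinates of an eigenvector, [d] the distances from the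
    eigenvalue to the diagonal entries, [w] the moduli of the matrix entries. *)
Lemma exists_le_row_col_sums (R : realType) (I : finType) (w : I -> I -> R)
    (u d : I -> R) (g : R) : 0 <= g <= 1 ->
  (forall i j, 0 <= w i j) -> (forall i, 0 <= u i) -> (exists i, u i != 0) ->
  (forall i, u i * d i <= \sum_(j | j != i) w i j * u j) ->
  exists i, d i <= (\sum_(j | j != i) w i j) `^ g *
                   (\sum_(j | j != i) w j i) `^ (1 - g).
Proof.
move=> /andP[g0 g1] w0 u0 [k uk] hd.
have uk0 : 0 < u k by rewrite lt_neqAle eq_sym uk u0.
(* For [g = 1] the exponent [1 / (1 - g)] degenerates to the sup norm. *)
have [->|gn1] := eqVneq g 1.
  have [i _ imax] := @Order.TotalTheory.arg_maxP _ _ _ k xpredT u isT.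
  have {}imax j : u j <= u i by exact: imax.
  exists i; rewrite subrr powRr0 mulr1 powRr1 ?sumr_ge0//.
  have ui0 : 0 < u i := lt_le_trans uk0 (imax k).
  rewrite -(ler_pM2l ui0) (le_trans (hd i))// mulr_sumr.
  by apply: ler_sum => j _; rewrite mulrC ler_wpM2r// imax.
have h0 : 0 < 1 - g by rewrite subr_gt0 lt_neqAle gn1.
pose y i := u i `^ (1 - g)^-1.
have y0 i : 0 <= y i by exact: powR_ge0.
have yK i : y i `^ (1 - g) = u i by rewrite -powRrM mulVf ?gt_eqF// powRr1.
pose S i := \sum_(j | j != i) w i j * y j.
pose c i := \sum_(j | j != i) w j i.
have S0 i : 0 <= S i by apply: sumr_ge0 => j _; rewrite mulr_ge0.
have c0 i : 0 <= c i by exact: sumr_ge0.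
have sumS : \sum_i S i = \sum_i c i * y i.
  rewrite (exchange_big_dep xpredT)//=; apply: eq_bigr => j _.
  by rewrite mulr_suml; apply: eq_bigl => i; rewrite eq_sym.
(* Otherwise [c j * y j <= S j] for all [j], strictly at [k], which
   contradicts [sumS]. *)
have [i yi Si] : exists2 i, 0 < y i & S i <= c i * y i.
  apply: contrapT => noi.
  have lt_cS i : 0 < y i -> c i * y i < S i.
    by move=> yi; rewrite ltNge; apply/negP => Si; apply: noi; exists i.
  have le_cS i : c i * y i <= S i.
    have [/eqP ->|yn0] := boolP (y i == 0); first by rewrite mulr0.
    by apply/ltW/lt_cS; rewrite lt_neqAle eq_sym yn0 y0.
  suff : \sum_i c i * y i < \sum_i S i by rewrite sumS ltxx.
  rewrite (bigD1 k)//= [ltRHS](bigD1 k)//=.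
  by apply: ltr_leD; [exact/lt_cS/powR_gt0 | exact: ler_sum].
have ui : 0 < u i by rewrite -yK powR_gt0.
exists i; rewrite -(ler_pM2l ui) (le_trans (hd i))//.
have g01 : 0 <= g < 1 by rewrite g0 lt_neqAle gn1.
under eq_bigr do rewrite -yK.
apply: le_trans (holder_weighted_sum _ _ (fun j => j != i) _ _ _ g01 (w0 i) y0) _.
rewrite mulrCA ler_wpM2l ?powR_ge0//.
rewrite -yK mulrC -(powRM _ (c0 i) (y0 i)).
exact: (ge0_ler_powR (ltW h0) (S0 i) (mulr_ge0 (c0 i) (y0 i)) Si).
Qed.

Lemma quat_real_comm (R : realType) (a : R) (q : quaternion R) :
  quat_real a * q = q * quat_real a.
Proof.
rewrite -[LHS]/(Defs.mulq (quat_real a) q) -[RHS]/(Defs.mulq q (quat_real a)).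
case: q => b c d e /=; rewrite !(mul0r, mulr0, subr0, addr0, add0r).
by rewrite !(mulrC a).
Qed.

(** The real diagonal enters here: moving [a_ii x_i] to the other side produces
    [x_i (lambda - a_ii)] only because [a_ii x_i = x_i a_ii]. *)
Lemma right_eigenvector_norm_le (R : realType) (n : nat)
    (A : 'M[quaternion R]_n) (lambda : quaternion R) (x : 'cV_n) (i : 'I_n) :
  (exists a : R, A i i = quat_real a) ->
  A *m x = map_mx (fun q => q * lambda) x ->
  `|x i 0| * `|lambda - A i i| <= \sum_(j | j != i) `|A i j| * `|x j 0|.
Proof.
move=> [a Aii] /matrixP /(_ i 0); rewrite !mxE (bigD1 i)//= => Axi.
have -> : `|x i 0| * `|lambda - A i i| = `|\sum_(j | j != i) A i j * x j 0|.
  by rewrite -quat_normM mulrBr -Axi Aii quat_real_comm addrAC subrr add0r.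
rewrite (le_trans (ler_norm_sum _ _ _))//.
by apply: ler_sum => j _; rewrite quat_normM.
Qed.

Theorem theorem3p4 (R : realType) (n : nat) (A : 'M[quaternion R]_n)
    (gamma : R) :
  (forall i : 'I_n, exists a : R, A i i = quat_real a) ->
  0 <= gamma <= 1 ->
  right_spectrum A `<=` \bigcup_(i in [set: 'I_n]) ostrowski_ball gamma A i.
Proof.
move=> Areal g01 lambda [x xn0 Ax].
have xk : exists k, `|x k 0| != 0.
  by have [k] := cV0Pn _ xn0; exists k; rewrite normr_eq0.
have [i Hi] := exists_le_row_col_sums _ _ (fun i j => `|A i j|)
  (fun i => `|x i 0|) (fun i => `|lambda - A i i|) _ g01
  (fun i j => normr_ge0 _) (fun i => normr_ge0 _) xk
  (fun i => right_eigenvector_norm_le _ _ _ _ _ _ (Areal i) Ax).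
by exists i.
Qed.
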